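(* Let $F$ be a field of characteristic $2$, let $V$ be a non-zero finite dimensional vector space over $F$, let $m=\dim(V)$, and let $f:V\times V\to F$ be a bilinear form. Then $\mathfrak{sl}(2,F)$ is isomorphic to $L(f)$ only when $m=2$ and $f$ is non-degenerate and alternating.
   Context: $L(f)=\{x\in\mathfrak{gl}(V)\mid f(xv,w)=-f(v,xw)\ \text{for all } v,w\in V\}$, a Lie subalgebra of $\mathfrak{gl}(V)$. Alternating means $f(v,v)=0$ for all $v\in V$. *)

(* Defs.v *)
From HB Require Import structures.
From mathcomp Require Import all_boot all_algebra.
From mathcomp Require Import boolp.

Set Implicit Arguments.
Unset Strict Implicit.
Unset Printing Implicit Defensive.

Import GRing.Theory.
Local Open Scope ring_scope.

HB.mixin Record isLieAlgebra (F : fieldType) L of GRing.Lmodule F L := {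
  lie : L -> L -> L;
  lie_linearl : forall y (a : F) x1 x2,
    lie (a *: x1 + x2) y = a *: lie x1 y + lie x2 y;
  lie_linearr : forall x (a : F) y1 y2,
    lie x (a *: y1 + y2) = a *: lie x y1 + lie x y2;
  liexx : forall x, lie x x = 0;
  lie_jacobi : forall x y z,
    lie x (lie y z) + lie y (lie z x) + lie z (lie x y) = 0
}.

#[short(type="lieAlgType")]
HB.structure Definition LieAlgebra (F : fieldType) :=
  {L of GRing.Lmodule F L & isLieAlgebra F L}.

Definition lie_isomorphic (F : fieldType) (L1 L2 : lieAlgType F) : Prop :=
  exists phi : {linear L1 -> L2},
    bijective phi /\ forall x y : L1, phi (lie x y) = lie (phi x) (phi y).

Lemma commutator_jacobi (M : zmodType) (mul : M -> M -> M)
    (mulDl : left_distributive mul +%R) (mulDr : right_distributive mul +%R)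
    (mulA : associative mul) (x y z : M) :
  let br u v := mul u v - mul v u in
  br x (br y z) + br y (br z x) + br z (br x y) = 0.
Proof.
have mul0l v : mul 0 v = 0.
  by apply: (addrI (mul 0 v)); rewrite -mulDl !addr0.
have mul0r v : mul v 0 = 0.
  by apply: (addrI (mul v 0)); rewrite -mulDr !addr0.
have mulNl u v : mul (- u) v = - mul u v.
  by apply: (addrI (mul u v)); rewrite -mulDl !subrr mul0l.
have mulNr u v : mul u (- v) = - mul u v.
  by apply: (addrI (mul u v)); rewrite -mulDr !subrr mul0r.
move=> br; rewrite {}/br !mulDl !mulDr !mulNl !mulNr !opprD !opprK !mulA.
set a := mul (mul x y) z; set b := mul (mul x z) y; set c := mul (mul y z) x.
set d := mul (mul z y) x; set e := mul (mul y x) z; set g := mul (mul z x) y.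
rewrite !addrA.
rewrite (ACl ((1*11)*(8*2)*(5*3)*(4*10)*(12*6)*(9*7))) /=.
by rewrite !subrr !addr0.
Qed.

Section MatrixLie.
Variables (F : fieldType) (n : nat).
Implicit Types A B : 'M[F]_n.

Definition mx_lie A B := A *m B - B *m A.

Fact mx_lie_linearl B a A1 A2 :
  mx_lie (a *: A1 + A2) B = a *: mx_lie A1 B + mx_lie A2 B.
Proof.
by rewrite /mx_lie mulmxDl mulmxDr -scalemxAl -scalemxAr opprD addrACA scalerBr.
Qed.

Fact mx_lie_linearr A a B1 B2 :
  mx_lie A (a *: B1 + B2) = a *: mx_lie A B1 + mx_lie A B2.
Proof.
by rewrite /mx_lie mulmxDl mulmxDr -scalemxAl -scalemxAr opprD addrACA scalerBr.
Qed.

Fact mx_liexx A : mx_lie A A = 0. Proof. exact: subrr. Qed.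

Fact mx_lie_jacobi A B C :
  mx_lie A (mx_lie B C) + mx_lie B (mx_lie C A) + mx_lie C (mx_lie A B) = 0.
Proof.
apply: (@commutator_jacobi _ (@mulmx F n n n)) => X Y Z.
- exact: mulmxDl.
- exact: mulmxDr.
- exact: mulmxA.
Qed.

HB.instance Definition _ := isLieAlgebra.Build F 'M[F]_n
  mx_lie_linearl mx_lie_linearr mx_liexx mx_lie_jacobi.

End MatrixLie.

Section EndLie.
Variables (F : fieldType) (V : vectType F).
Implicit Types x y z : 'End(V).

Definition end_lie x y : 'End(V) := ((x \o y) - (y \o x))%VF.

Fact end_lie_linearl y a x1 x2 :
  end_lie (a *: x1 + x2) y = a *: end_lie x1 y + end_lie x2 y.
Proof.
by rewrite /end_lie comp_lfunDl comp_lfunDr -comp_lfunZl -comp_lfunZr opprD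
  addrACA scalerBr.
Qed.

Fact end_lie_linearr x a y1 y2 :
  end_lie x (a *: y1 + y2) = a *: end_lie x y1 + end_lie x y2.
Proof.
by rewrite /end_lie comp_lfunDl comp_lfunDr -comp_lfunZl -comp_lfunZr opprD
  addrACA scalerBr.
Qed.

Fact end_liexx x : end_lie x x = 0. Proof. exact: subrr. Qed.

Fact end_lie_jacobi x y z :
  end_lie x (end_lie y z) + end_lie y (end_lie z x) + end_lie z (end_lie x y)
  = 0.
Proof.
apply: (@commutator_jacobi _ (@comp_lfun F V V V)) => f g h.
- exact: comp_lfunDl.
- exact: comp_lfunDr.
- exact: comp_lfunA.
Qed.

HB.instance Definition _ := isLieAlgebra.Build F 'End(V)
  end_lie_linearl end_lie_linearr end_liexx end_lie_jacobi.

End EndLie.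

Section SpecialLinear.
Variables (F : fieldType) (n : nat).

Definition traceless : {pred 'M[F]_n} := [pred A | \tr A == 0].

Fact traceless_submod : submod_closed traceless.
Proof.
split=> [|a A B]; rewrite !inE ?mxtrace0 // => /eqP trA /eqP trB.
by rewrite mxtraceD mxtraceZ trA trB mulr0 addr0.
Qed.

HB.instance Definition _ :=
  GRing.isSubmodClosed.Build F 'M[F]_n traceless traceless_submod.

Record sl := Sl {slval :> 'M[F]_n; _ : slval \in traceless}.

HB.instance Definition _ := [isSub for slval].
HB.instance Definition _ := [Choice of sl by <:].
HB.instance Definition _ := [SubChoice_isSubLmodule of sl by <:].

Fact sl_lie_subproof (A B : sl) : lie (val A) (val B) \in traceless.
Proof. by rewrite inE linearB /= mxtrace_mulC subrr. Qed.

Definition sl_lie (A B : sl) : sl := Sl (sl_lie_subproof A B).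

Fact sl_lie_linearl B a A1 A2 :
  sl_lie (a *: A1 + A2) B = a *: sl_lie A1 B + sl_lie A2 B.
Proof. by apply: val_inj; rewrite /= lie_linearl. Qed.

Fact sl_lie_linearr A a B1 B2 :
  sl_lie A (a *: B1 + B2) = a *: sl_lie A B1 + sl_lie A B2.
Proof. by apply: val_inj; rewrite /= lie_linearr. Qed.

Fact sl_liexx A : sl_lie A A = 0.
Proof. by apply: val_inj; rewrite /= liexx. Qed.

Fact sl_lie_jacobi A B C :
  sl_lie A (sl_lie B C) + sl_lie B (sl_lie C A) + sl_lie C (sl_lie A B) = 0.
Proof. by apply: val_inj; rewrite /= lie_jacobi. Qed.

HB.instance Definition _ := isLieAlgebra.Build F sl
  sl_lie_linearl sl_lie_linearr sl_liexx sl_lie_jacobi.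

End SpecialLinear.

Section LieAlgebraOfForm.
Variables (F : fieldType) (V : vectType F) (f : {biscalar V}).

Definition skew_adjoint : {pred 'End(V)} :=
  [pred x : 'End(V) | `[< forall v w : V, f (x v) w = - f v (x w) >]].

Fact skew_adjointP (x : 'End(V)) :
  reflect (forall v w : V, f (x v) w = - f v (x w)) (x \in skew_adjoint).
Proof. exact: asboolP. Qed.

Fact skew_adjoint_submod : submod_closed skew_adjoint.
Proof.
split=> [|a x y /skew_adjointP fx /skew_adjointP fy]; apply/skew_adjointP => v w.
  by rewrite !lfunE /= linear0l linear0r oppr0.
rewrite !(add_lfunE, scale_lfunE) linearDl linearDr linearZl_LR linearZr_LR /=.
by rewrite fx fy opprD mulrN.
Qed.

HB.instance Definition _ :=
  GRing.isSubmodClosed.Build F 'End(V) skew_adjoint skew_adjoint_submod.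

Record Lform := LForm {Lform_val :> 'End(V); _ : Lform_val \in skew_adjoint}.

HB.instance Definition _ := [isSub for Lform_val].
HB.instance Definition _ := [Choice of Lform by <:].
HB.instance Definition _ := [SubChoice_isSubLmodule of Lform by <:].

Fact Lform_lie_subproof (x y : Lform) : lie (val x) (val y) \in skew_adjoint.
Proof.
case: x y => x xL [y yL] /=; move/skew_adjointP: xL => fx.
move/skew_adjointP: yL => fy.
apply/skew_adjointP => v w; rewrite !(add_lfunE, opp_lfunE, comp_lfunE) /=.
by rewrite linearBl linearBr !(fx, fy) !opprK opprB.
Qed.

Definition Lform_lie (x y : Lform) : Lform := LForm (Lform_lie_subproof x y).

Fact Lform_lie_linearl y a x1 x2 :
  Lform_lie (a *: x1 + x2) y = a *: Lform_lie x1 y + Lform_lie x2 y.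
Proof. by apply: val_inj; rewrite /= lie_linearl. Qed.

Fact Lform_lie_linearr x a y1 y2 :
  Lform_lie x (a *: y1 + y2) = a *: Lform_lie x y1 + Lform_lie x y2.
Proof. by apply: val_inj; rewrite /= lie_linearr. Qed.

Fact Lform_liexx x : Lform_lie x x = 0.
Proof. by apply: val_inj; rewrite /= liexx. Qed.

Fact Lform_lie_jacobi x y z :
  Lform_lie x (Lform_lie y z) + Lform_lie y (Lform_lie z x)
  + Lform_lie z (Lform_lie x y) = 0.
Proof. by apply: val_inj; rewrite /= lie_jacobi. Qed.

HB.instance Definition _ := isLieAlgebra.Build F Lform
  Lform_lie_linearl Lform_lie_linearr Lform_liexx Lform_lie_jacobi.

(* The library's [nondegenerate] is only available for hermitian forms; for a
   general bilinear form both the left and the right radical must vanish. *)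
Definition nondegenerate_form : Prop :=
  (forall v, (forall w, f v w = 0) -> v = 0)
  /\ (forall w, (forall v, f v w = 0) -> w = 0).

Definition alternating_form : Prop := forall v, f v v = 0.

End LieAlgebraOfForm.

(* Main.v *)
Require Import Defs.
From HB Require Import structures.
From mathcomp Require Import all_boot all_algebra.
From mathcomp Require Import boolp ring.

Import GRing.Theory.
Local Open Scope ring_scope.

(** In characteristic 2 the matrix h = [e, f] of sl(2, F) is the identity, so
    sl(2, F) is the Heisenberg algebra: brackets are multiples of one central
    element and the centre is the line through it. On the other side -1 = 1
    makes the elements of L(f) the self-adjoint endomorphisms of V for f. In
    particular L(f) contains the identity of V, and it is closed under
    squares. An isomorphism must match the centres, so L(f) has the following
    three properties ([form_algebra_heisenberg]): brackets are scalar, central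
    elements are scalar, and [x, y] = 1 for some x, y in L(f). Hence x and y
    have no common eigenvector, and the square of an element of L(f), being
    central, is scalar ([square_scalar]). Everything follows by writing down
    self-adjoint endomorphisms and confronting them with these facts.

    Nondegeneracy. For r in the left radical and s in the right radical, the
    endomorphism v |-> f(s,v) r + f(v,r) s lies in L(f). Its square is scalar,
    which forces f(s,r) = 0 since otherwise r would be a common eigenvector of
    x and y; then it is seen to be central, hence zero, so that r or s is zero
    ([radical_trivial]). As both radicals have the same dimension, both vanish.

    Symmetry. Let sg be the asymmetry, f(v,w) = f(w, sg v). It commutes with
    L(f), and sg + sg^-1 belongs to L(f), hence is a scalar t. If t were
    nonzero, q = x y + sg / t would lie in L(f), because both x y and sg / t
    satisfy f(p v, w) + f(v, p w) = f(v, w); but [q, x] = x up to sign is not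
    scalar. So t = 0, sg itself lies in L(f), it is a scalar with square 1,
    and therefore sg = 1 ([form_symmetric]).

    Conclusion. For symmetric f the rank one maps v (x) f(v,.) lie in L(f).
    Their squares f(v,v) v (x) f(v,.) are scalar, so f is alternating. The
    bracket of two of them, f(u,v) (u (x) f(v,.) - v (x) f(u,.)), is scalar,
    and nonzero when f(u,v) is, so V is the plane spanned by u and v. *)

Set Implicit Arguments.
Unset Strict Implicit.
Unset Printing Implicit Defensive.

(** * Linear maps, functionals and rank one endomorphisms *)

Lemma oppv_pchar2 (F : fieldType) (V : lmodType F) (v : V) :
  2%N \in [pchar F] -> - v = v.
Proof. by move=> char2; rewrite -scaleN1r oppr_pchar2 // scale1r. Qed.

Section LinearMaps.
Variables (F : fieldType) (V W : vectType F) (g : V -> W) (lin_g : linear g).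

(** Turns a plain function into a linear map from a proof of its linearity,
    with no structure declared on the function. *)
Definition lfun_of : 'Hom(V, W) :=
  linfun (HB.pack_for {linear V -> W} g
    (GRing.isLinear.Build F V W *:%R g lin_g)).

Lemma lfun_ofE v : lfun_of v = g v.
Proof. by rewrite lfunE. Qed.

End LinearMaps.

Section Functionals.
Variables (F : fieldType) (V : vectType F).
Implicit Types (u v : V) (phi psi : 'Hom(V, F^o)) (z w : 'End(V)).

Lemma lieE z w v : lie z w v = z (w v) - w (z v).
Proof. by rewrite !(add_lfunE, opp_lfunE, comp_lfunE). Qed.

Lemma functional_separates v : (forall phi, phi v = 0) -> v = 0.
Proof.
move=> v0; rewrite (coord_vbasis (memvf v)); apply: big1 => i _.
have := v0 (linfun (coord (vbasis fullv) i : V -> F^o)).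
by rewrite lfunE /= => ->; rewrite scale0r.
Qed.

Lemma dim_dual : \dim {:'Hom(V, F^o)} = \dim {:V}.
Proof. by rewrite !dimvf [LHS]muln1. Qed.

Lemma inj_dual_cancel (g : 'Hom(V, 'Hom(V, F^o))) :
  (forall v, g v = 0 -> v = 0) -> cancel g^-1%VF g.
Proof.
move=> inj_g; have ker_g : lker g = 0%VS.
  apply/eqP; rewrite -subv0; apply/subvP => v; rewrite memv_ker memv0.
  by move/eqP/inj_g->.
move=> phi; apply: limg_lfunVK; suff -> : limg g = fullv by apply: memvf.
apply/eqP; rewrite eqEdim subvf (limg_dim_eq (U := fullv)) ?ker_g ?capv0 //.
by rewrite dim_dual leqnn.
Qed.

Fact outer_linear u phi : linear (fun v => (phi v : F) *: u).
Proof. by move=> a v w; rewrite linearP /= scalerDl scalerA. Qed.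

(** The tensor u (x) phi, seen as an endomorphism. *)
Definition outer u phi : 'End(V) := lfun_of (outer_linear u phi).

Lemma outerE u phi v : outer u phi v = (phi v : F) *: u.
Proof. exact: lfun_ofE. Qed.

Lemma outer_comp u phi (u' : V) psi v :
  outer u phi (outer u' psi v) = ((psi v : F) * (phi u' : F)) *: u.
Proof. by rewrite !outerE linearZ. Qed.

End Functionals.

(** * The two maps from V to its dual given by a bilinear form *)

Section FormDuality.
Variables (F : fieldType) (V : vectType F) (f : {biscalar V}).

Fact form_left_linear v : linear (f v : V -> F^o).
Proof. by move=> a u w; rewrite linearDr linearZr_LR. Qed.

Definition form_left v : 'Hom(V, F^o) := lfun_of (form_left_linear v).

Lemma form_leftE v w : form_left v w = f v w.
Proof. exact: lfun_ofE. Qed.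

Fact form_right_linear v : linear (fun w => f w v : F^o).
Proof. by move=> a u w; rewrite linearDl linearZl_LR. Qed.

Definition form_right v : 'Hom(V, F^o) := lfun_of (form_right_linear v).

Lemma form_rightE v w : form_right v w = f w v.
Proof. exact: lfun_ofE. Qed.

Fact dual_left_linear : linear form_left.
Proof.
move=> a u w; apply/lfunP => v.
by rewrite add_lfunE scale_lfunE !form_leftE linearDl linearZl_LR.
Qed.

Fact dual_right_linear : linear form_right.
Proof.
move=> a u w; apply/lfunP => v.
by rewrite add_lfunE scale_lfunE !form_rightE linearDr linearZr_LR.
Qed.

Definition dual_left := lfun_of dual_left_linear.
Definition dual_right := lfun_of dual_right_linear.

Lemma dual_leftE v w : dual_left v w = f v w.
Proof. by rewrite lfun_ofE form_leftE. Qed.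

Lemma dual_rightE v w : dual_right v w = f w v.
Proof. by rewrite lfun_ofE form_rightE. Qed.

Definition in_radl (v : V) := forall w, f v w = 0.
Definition in_radr (w : V) := forall v, f v w = 0.

Lemma dual_leftK :
  (forall v, in_radl v -> v = 0) -> cancel dual_left^-1%VF dual_left.
Proof.
move=> radl0; apply: inj_dual_cancel => v fv; apply: radl0 => u.
by rewrite -dual_leftE fv lfunE.
Qed.

Lemma dual_rightK :
  (forall w, in_radr w -> w = 0) -> cancel dual_right^-1%VF dual_right.
Proof.
move=> radr0; apply: inj_dual_cancel => v fv; apply: radr0 => u.
by rewrite -dual_rightE fv lfunE.
Qed.

(** When the left radical is zero, every functional is of the form f(v,.), so a
    vector of the right radical is killed by all functionals. *)
Lemma radl0_radr0 :
  (forall v, in_radl v -> v = 0) -> forall w, in_radr w -> w = 0.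
Proof.
move=> radl0 w fw; apply: functional_separates => phi.
by rewrite -[phi](dual_leftK radl0) dual_leftE.
Qed.

Lemma radr0_radl0 :
  (forall w, in_radr w -> w = 0) -> forall v, in_radl v -> v = 0.
Proof.
move=> radr0 v fv; apply: functional_separates => phi.
by rewrite -[phi](dual_rightK radr0) dual_rightE.
Qed.

End FormDuality.

(** * Forms in characteristic 2 whose algebra L(f) is a Heisenberg algebra *)

Section HeisenbergForm.
Variables (F : fieldType) (V : vectType F) (f : {biscalar V}).
Hypothesis char2 : 2%N \in [pchar F].
Notation L := (skew_adjoint f).
Implicit Types (u v r s : V) (z w : 'End(V)).

Lemma self_adjointP z : reflect (forall u v, f (z u) v = f u (z v)) (z \in L).
Proof.
by apply: (iffP (skew_adjointP _ _)) => fz u v; rewrite fz // oppr_pchar2.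
Qed.

Lemma id_self_adjoint : \1%VF \in L.
Proof. by apply/self_adjointP => u v; rewrite !id_lfunE. Qed.

Hypothesis lie_scalar : forall z w, z \in L -> w \in L ->
  exists c, lie z w = c *: \1%VF.
Hypothesis centre_scalar : forall z, z \in L ->
  (forall w, w \in L -> lie z w = 0) -> exists c, z = c *: \1%VF.
Variables x y : 'End(V).
Hypotheses (xL : x \in L) (yL : y \in L) (lie_xy : lie x y = \1%VF).
Hypothesis V_neq0 : exists v : V, v != 0.

Lemma lie_scalarE z w : z \in L -> w \in L ->
  exists c, forall v, z (w v) - w (z v) = c *: v.
Proof.
move=> zL wL; have [c zw] := lie_scalar zL wL; exists c => v.
by rewrite -lieE zw scale_lfunE id_lfunE.
Qed.

Lemma commuting_scalar z : z \in L ->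
  (forall w v, w \in L -> z (w v) = w (z v)) -> exists c, forall v, z v = c *: v.
Proof.
move=> zL zC; have [|c ->] := centre_scalar zL.
  by move=> w wL; apply/lfunP => v; rewrite lieE zC // subrr lfunE.
by exists c => v; rewrite scale_lfunE id_lfunE.
Qed.

Lemma weyl_relation v : x (y v) - y (x v) = v.
Proof. by rewrite -lieE lie_xy id_lfunE. Qed.

Lemma no_common_eigenvector r a b : x r = a *: r -> y r = b *: r -> r = 0.
Proof.
move=> xr yr; have := weyl_relation r.
by rewrite xr yr !linearZ /= xr yr scalerN !scalerA mulrC subrr.
Qed.

Lemma not_line r : ~ forall v : V, exists a, v = a *: r.
Proof.
move=> line; have [a xr] := line (x r); have [b yr] := line (y r).
have r0 := no_common_eigenvector xr yr.
by have [v /eqP[]] := V_neq0; have [c ->] := line v; rewrite r0 scaler0.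
Qed.

(** The square is again self-adjoint, and it is central: if [z, w] = c then
    [z^2, w] = 2 c z = 0. *)
Lemma square_scalar z : z \in L -> exists c, forall v, z (z v) = c *: v.
Proof.
move=> zL; have [||c zz] := commuting_scalar (z := (z \o z)%VF).
- by apply/self_adjointP => u v; rewrite !comp_lfunE !(self_adjointP _ zL).
- move=> w v wL; rewrite !comp_lfunE.
  have [c zw] := lie_scalarE zL wL.
  have {}zw u : z (w u) = w (z u) + c *: u by rewrite -zw addrC subrK.
  rewrite !zw linearD linearZ /= zw -addrA -scalerDr.
  by rewrite -[X in X + z v](oppv_pchar2 _ char2) addNr scaler0 addr0.
by exists c => v; rewrite -zz comp_lfunE.
Qed.

(** The square phi(u) u (x) phi is scalar, and its image is at most a line. *)
Lemma rank_one_self_adjoint u phi : u != 0 -> outer u phi \in L -> phi u = 0.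
Proof.
move=> u_neq0 /square_scalar[c zz]; apply/eqP; apply/negP => /negP phiu.
apply: (@not_line u) => v.
have := zz u; rewrite outer_comp => /eqP.
rewrite -subr_eq0 -scalerBl scaler_eq0 (negPf u_neq0) orbF subr_eq0.
move=> /eqP c_def; exists ((phi u * phi u)^-1 * (phi v * phi u)).
by rewrite -scalerA -outer_comp zz -c_def scalerA mulVf ?scale1r ?mulf_neq0.
Qed.

(** Every endomorphism with image in both radicals is trivially self-adjoint,
    so r (x) phi belongs to L(f) whatever phi is. *)
Lemma radicals_disjoint r : in_radl f r -> in_radr f r -> r = 0.
Proof.
move=> rl rr; apply/eqP; apply: contraT => r_neq0; case/eqP: (r_neq0).
apply: functional_separates => phi; apply: (rank_one_self_adjoint r_neq0).
apply/self_adjointP => u v.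
by rewrite !outerE linearZl_LR linearZr_LR /= rl rr !mulr0.
Qed.

(** The sum of r (x) f(s,.) and s (x) f(.,r). Neither term is self-adjoint in
    general, but when r and s lie in the left and right radicals the two are
    adjoint to each other. *)
Definition cross r s := outer r (form_left f s) + outer s (form_right f r).

Lemma crossE r s v : cross r s v = f s v *: r + f v r *: s.
Proof. by rewrite add_lfunE !outerE form_leftE form_rightE. Qed.

Lemma cross_self_adjoint r s : in_radl f r -> in_radr f s -> cross r s \in L.
Proof.
move=> rl sr; apply/self_adjointP => u v.
rewrite !crossE linearDl linearDr !linearZl_LR !linearZr_LR /=.
by rewrite rl sr !mulr0 add0r addr0 mulrC.
Qed.

Lemma radl_stable w r : w \in L -> in_radl f r -> in_radl f (w r).
Proof. by move=> /self_adjointP fw rl v; rewrite fw rl. Qed.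

Lemma radr_stable w s : w \in L -> in_radr f s -> in_radr f (w s).
Proof. by move=> /self_adjointP fw sr v; rewrite -fw sr. Qed.

(** On the left radical, [cross r s] takes its values in the line of r and its
    square is the scalar f(s,r)^2. If that is nonzero the left radical is this
    line, and it is stable under x and y: r would be a common eigenvector. *)
Lemma radicals_orthogonal r s : in_radl f r -> in_radr f s -> f s r = 0.
Proof.
move=> rl sr; have [->|r_neq0] := eqVneq r 0; first by rewrite linear0r.
apply/eqP; apply: contraT => fsr.
have [c zz] := square_scalar (cross_self_adjoint rl sr).
have z_sq v : in_radl f v -> cross r s (cross r s v) = (f s v * f s r) *: r.
  move=> vl; rewrite [cross r s v]crossE vl scale0r addr0 linearZ /=.
  by rewrite crossE rl scale0r addr0 scalerA.
have line w : w \in L -> exists a, w r = a *: r.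
  move=> wL; exists (f s (w r) / f s r); apply: (scalerI (mulf_neq0 fsr fsr)).
  have := zz r; rewrite z_sq // => /eqP.
  rewrite -subr_eq0 -scalerBl scaler_eq0 (negPf r_neq0) orbF subr_eq0.
  move=> /eqP e; rewrite [in LHS]e -zz z_sq; last exact: radl_stable.
  by rewrite scalerA mulrACA mulfV // mulr1 mulrC.
have [a xr] := line x xL; have [b yr] := line y yL.
by rewrite (no_common_eigenvector xr yr) eqxx in r_neq0.
Qed.

(** The bracket with w is a scalar c, and its image lies in the sum of the two
    radicals. If c were nonzero the radicals would span V, so that r, being
    orthogonal to both of them, would also lie in the right radical. *)
Lemma cross_central r s w v :
  r != 0 -> in_radl f r -> in_radr f s -> w \in L ->
  cross r s (w v) = w (cross r s v).
Proof.
move=> r_neq0 rl sr wL.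
have [c zw] := lie_scalarE (cross_self_adjoint rl sr) wL.
have [c0|c_neq0] := eqVneq c 0.
  by apply/eqP; rewrite -subr_eq0 zw c0 scale0r.
case/eqP: (r_neq0); apply: radicals_disjoint => // u; apply: (mulfI c_neq0).
have wrl := radl_stable wL rl; have wsr := radr_stable wL sr.
rewrite mulr0 -[c * _]linearZl_LR -zw !crossE linearD !linearZ /=.
rewrite linearBl !linearDl !linearZl_LR /= rl wrl.
rewrite (radicals_orthogonal rl sr) (radicals_orthogonal rl wsr).
by rewrite !mulr0 !addr0 subr0.
Qed.

Lemma radical_trivial r s : in_radl f r -> in_radr f s -> (r == 0) || (s == 0).
Proof.
move=> rl sr; apply: contraT; rewrite negb_or => /andP[r_neq0 s_neq0].
have [|a za] := commuting_scalar (cross_self_adjoint rl sr).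
  by move=> w v wL; apply: cross_central.
(* Evaluating at r shows that the scalar a is zero. *)
have a0 : a = 0.
  apply/eqP; have /eqP := za r.
  rewrite crossE rl (radicals_orthogonal rl sr) !scale0r addr0 eq_sym.
  by rewrite scaler_eq0 (negPf r_neq0) orbF.
(* Now f(s,v) r = - f(v,r) s is in both radicals, so s is in both of them. *)
case/eqP: s_neq0; apply: radicals_disjoint => // v.
have := za v; rewrite a0 scale0r crossE => /eqP.
rewrite addr_eq0 => /eqP e; apply/eqP.
have /eqP : f s v *: r = 0.
  apply: radicals_disjoint => u; first by rewrite linearZl_LR /= rl mulr0.
  by rewrite e linearNr linearZr_LR /= sr mulr0 oppr0.
by rewrite scaler_eq0 (negPf r_neq0) orbF.
Qed.

Lemma form_nondegenerate : nondegenerate_form f.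
Proof.
case: (boolP (lker (dual_left f) == 0%VS)) => ker.
  have radl0 v : in_radl f v -> v = 0.
    move=> vl; apply/eqP; rewrite -memv0 -(eqP ker) memv_ker; apply/eqP.
    by apply/lfunP => w; rewrite dual_leftE lfunE vl.
  by split; last exact: radl0_radr0.
have r_neq0 := ker; rewrite -vpick0 in r_neq0.
have rl : in_radl f (vpick (lker (dual_left f))).
  move=> w; have := memv_pick (lker (dual_left f)).
  by rewrite memv_ker -dual_leftE => /eqP->; rewrite lfunE.
case/eqP: (r_neq0); apply: (radr0_radl0 _ rl) => s sr.
by have := radical_trivial rl sr; rewrite (negPf r_neq0) => /eqP.
Qed.

(** sg is the asymmetry of the form and sg' is its inverse. *)
Lemma asymmetries : exists sg sg' : 'End(V),
  (forall u v, f u v = f v (sg u)) /\ (forall u v, f u v = f (sg' v) u).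
Proof.
have [radl0 radr0] := form_nondegenerate.
exists ((dual_right f)^-1 \o dual_left f)%VF.
exists ((dual_left f)^-1 \o dual_right f)%VF.
split=> u v; rewrite comp_lfunE.
  by rewrite -[RHS]dual_rightE (dual_rightK radr0) dual_leftE.
by rewrite -[RHS]dual_leftE (dual_leftK radl0) dual_rightE.
Qed.

Lemma form_symmetric u v : f u v = f v u.
Proof.
have [radl0 radr0] := form_nondegenerate.
have [sg [sg' [fsg fsg']]] := asymmetries.
have eqr (a b : V) : (forall t, f t a = f t b) -> a = b.
  by move=> e; apply/eqP; rewrite -subr_eq0; apply/eqP/radr0 => t;
    rewrite linearBr /= e subrr.
have eql (a b : V) : (forall t, f a t = f b t) -> a = b.
  by move=> e; apply/eqP; rewrite -subr_eq0; apply/eqP/radl0 => t;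
    rewrite linearBl /= e subrr.
have sgK a : sg (sg' a) = a by apply: eqr => t; rewrite -fsg -fsg'.
have sg_adj a b : f (sg a) b = f a (sg' b) by rewrite (fsg a) fsg'.
have sg'_adj a b : f (sg' a) b = f a (sg b) by rewrite -fsg' -fsg.
have sgC z a : z \in L -> sg (z a) = z (sg a).
  by move=> /self_adjointP fz; apply: eqr => t; rewrite -fsg -fz -fsg fz.
have sg'C z a : z \in L -> sg' (z a) = z (sg' a).
  by move=> /self_adjointP fz; apply: eql => t; rewrite -fsg' fz -fsg' fz.
(* sg and sg' are adjoint to each other, so their sum is self-adjoint. *)
have [||t tE] := commuting_scalar (z := sg + sg').
- apply/self_adjointP => a b.
  rewrite !add_lfunE linearDl linearDr /= sg_adj sg'_adj.
  exact: addrC.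
- by move=> z a zL; rewrite !add_lfunE linearD /= sgC ?sg'C.
have {}tE a : sg a + sg' a = t *: a by rewrite -tE add_lfunE.
have [t0|t_neq0] := eqVneq t 0.
(* sg is then self-adjoint, hence a scalar c, with c^2 = sg sg' = 1. *)
  have sgE a : sg' a = sg a.
    apply/esym/eqP.
    by rewrite -[sg' a](oppv_pchar2 _ char2) -addr_eq0 tE t0 scale0r.
  have [||c cE] := commuting_scalar (z := sg).
  - by apply/self_adjointP => a b; rewrite sg_adj sgE.
  - by move=> z a zL; rewrite sgC.
  have [a a_neq0] := V_neq0.
  have : c ^+ 2 - 1 == 0.
    have /eqP := sgK a; rewrite sgE !cE scalerA -subr_eq0 -{2}[a]scale1r.
    by rewrite -scalerBl scaler_eq0 (negPf a_neq0) orbF.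
  rewrite subr_sqr_1 mulf_eq0 -{2}[1](oppr_pchar2 char2) orbb subr_eq0.
  by rewrite fsg cE => /eqP->; rewrite scale1r.
(* The adjoint of x y is y x = x y - 1 and that of sg / t is 1 - sg / t, so the
   two defects cancel in q. *)
pose q : 'End(V) := (x \o y + t^-1 *: sg)%VF.
have qE a : q a = x (y a) + t^-1 *: sg a.
  by rewrite add_lfunE scale_lfunE comp_lfunE.
have qL : q \in L.
  apply/self_adjointP => a b.
  rewrite !qE linearDl linearDr linearZl_LR linearZr_LR /=.
  rewrite (self_adjointP _ xL) (self_adjointP _ yL) sg_adj.
  have -> : y (x b) = x (y b) - b by rewrite -[X in _ - X]weyl_relation subKr.
  have -> : sg' b = t *: b - sg b by rewrite -tE addrC addKr.
  rewrite !linearB /= linearZr_LR /= mulrBr mulKf //.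
  by rewrite addrA subrK oppr_pchar2.
(* [q, x] = - x is scalar, which contradicts [x, y] = 1. *)
have [c cE] := lie_scalarE qL xL.
have xE a : x a = - c *: a.
  rewrite scaleNr -cE !qE [x (_ + _)]linearD linearZ /= sgC //.
  rewrite [x (x _) + _]addrC addrKA.
  by rewrite -linearB /= -opprB weyl_relation linearN opprK.
have [a /eqP[]] := V_neq0.
by rewrite -[a]weyl_relation !xE linearZ subrr.
Qed.

Lemma form_rank_one_self_adjoint v : outer v (form_left f v) \in L.
Proof.
apply/self_adjointP => a b.
rewrite !outerE !form_leftE linearZl_LR linearZr_LR /= [f a v]form_symmetric.
exact: mulrC.
Qed.

Lemma form_alternating : alternating_form f.
Proof.
move=> v; have [->|v_neq0] := eqVneq v 0; first by rewrite linear0l.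
rewrite -form_leftE; apply: rank_one_self_adjoint => //.
exact: form_rank_one_self_adjoint.
Qed.

Lemma form_space_dim : \dim {:V} = 2%N.
Proof.
have [u u_neq0] := V_neq0; have [radl0 _] := form_nondegenerate.
have [v fuv] : exists v, f u v != 0.
  suff /existsNP[v /eqP] : ~ forall v, f u v = 0 by exists v.
  by move/radl0/eqP; rewrite (negPf u_neq0).
have [c cE] := lie_scalarE (form_rank_one_self_adjoint u)
                           (form_rank_one_self_adjoint v).
have {}cE a : (f u v * f v a) *: u - (f v u * f u a) *: v = c *: a.
  by rewrite -cE !outer_comp !form_leftE [f v a * _]mulrC [f u a * _]mulrC.
(* At a = u the identity reads f(u,v) f(v,u) u = c u. *)
have c_neq0 : c != 0.
  apply: contra_neq u_neq0 => c0; have := cE u.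
  rewrite form_alternating mulr0 scale0r subr0 c0 scale0r => /eqP.
  by rewrite scaler_eq0 (form_symmetric v) mulf_eq0 (negPf fuv) => /eqP.
have uv_full : <<[:: u; v]>>%VS = fullv.
  apply/eqP; rewrite eqEsubv subvf; apply/subvP => a _.
  rewrite -[a](scalerK c_neq0) -cE memvZ // memvB // memvZ // memv_span //.
    by rewrite mem_head.
  by rewrite !inE eqxx orbT.
have uv_free : free [:: u; v].
  rewrite free_cons span_seq1 seq1_free; apply/andP; split.
    apply/vlineP => -[a ua].
    by rewrite ua linearZl_LR /= form_alternating mulr0 eqxx in fuv.
  by apply: contra_neq fuv => ->; rewrite linear0r.
by rewrite -uv_full (eqP uv_free).
Qed.

End HeisenbergForm.

(** * In characteristic 2, sl(2, F) is a Heisenberg algebra *)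

Section Sl2.
Variable F : fieldType.
Hypothesis char2 : 2%N \in [pchar F].
Implicit Types A B : sl F 2.

Let i0 : 'I_2 := ord0.
Let i1 : 'I_2 := lift ord0 ord0.

Lemma matrix2P (A B : 'M[F]_2) :
  A i0 i0 = B i0 i0 -> A i0 i1 = B i0 i1 -> A i1 i0 = B i1 i0 ->
  A i1 i1 = B i1 i1 -> A = B.
Proof.
move=> e00 e01 e10 e11; apply/matrixP.
have I2 (i : 'I_2) : i = i0 \/ i = i1.
  by case: i => -[|[|//]] lt_i; [left | right]; apply: val_inj.
by move=> i j; case: (I2 i) => ->; case: (I2 j) => ->.
Qed.

Lemma sl2_diag A : val A i1 i1 = val A i0 i0.
Proof.
case: A => A /=; rewrite inE /mxtrace !big_ord_recl big_ord0 addr0 addr_eq0.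
by move=> /eqP->; rewrite oppr_pchar2.
Qed.

Fact sl2_one_subproof : (1%:M : 'M[F]_2) \in @traceless F 2.
Proof. by rewrite inE mxtrace1 (pcharf0 char2). Qed.

Definition sl2_one : sl F 2 := Sl sl2_one_subproof.

Lemma sl2_scalar_entry c i j : val (c *: sl2_one) i j = c *+ (i == j).
Proof. by rewrite !mxE mulrnAr mulr1. Qed.

Lemma sl2_one_neq0 : sl2_one != 0.
Proof.
apply/eqP => /(congr1 (fun A : sl F 2 => val A i0 i0)).
by rewrite !mxE /= => /eqP; rewrite oner_eq0.
Qed.

(** A traceless matrix has equal diagonal entries a, hence is the sum of the
    scalar a and of an antidiagonal matrix; only the latter contributes. *)
Lemma sl2_lie A B :
  lie A B = (val A i0 i1 * val B i1 i0 - val B i0 i1 * val A i1 i0) *: sl2_one.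
Proof.
have mulE (M N : 'M[F]_2) i j :
    (M *m N) i j = M i i0 * N i0 j + M i i1 * N i1 j.
  by rewrite mxE !big_ord_recl big_ord0 addr0.
have lie_entry i j : val (lie A B) i j =
    val A i i0 * val B i0 j + val A i i1 * val B i1 j
    - (val B i i0 * val A i0 j + val B i i1 * val A i1 j).
  by rewrite [LHS]mxE [X in _ + X = _]mxE !mulE.
apply: val_inj; apply: matrix2P;
  rewrite lie_entry sl2_scalar_entry ?sl2_diag /=.
- by rewrite mulr1n; ring.
- by rewrite mulr0n; ring.
- by rewrite mulr0n; ring.
- by rewrite mulr1n -[RHS](oppr_pchar2 char2); ring.
Qed.

Fact sl2_unit_subproof (i j : 'I_2) :
  i != j -> (delta_mx i j : 'M[F]_2) \in @traceless F 2.
Proof.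
move=> ij; rewrite inE /mxtrace big1 // => k _; rewrite mxE.
by case: eqP => // ->; rewrite (negPf ij).
Qed.

Definition sl2_e : sl F 2 := Sl (sl2_unit_subproof (isT : i0 != i1)).
Definition sl2_f : sl F 2 := Sl (sl2_unit_subproof (isT : i1 != i0)).

Lemma sl2_lie_ef c : lie sl2_e (c *: sl2_f) = c *: sl2_one.
Proof. by rewrite sl2_lie /= !mxE /= mul1r mulr1 !mulr0 subr0. Qed.

(** The brackets of A with e and f are its off-diagonal entries. *)
Lemma sl2_centre A : (forall B, lie A B = 0) -> exists c, A = c *: sl2_one.
Proof.
move=> AC; exists (val A i0 i0); have := AC sl2_e; have := AC sl2_f.
rewrite !sl2_lie /= !mxE /= !mulr1 !mulr0 !mul0r !mul1r subr0 sub0r => /eqP.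
rewrite scaler_eq0 (negPf sl2_one_neq0) orbF => /eqP A01 /eqP.
rewrite scaler_eq0 (negPf sl2_one_neq0) orbF oppr_eq0 => /eqP A10.
by apply: val_inj; apply: matrix2P;
  rewrite sl2_scalar_entry /= ?A01 ?A10 //; exact: sl2_diag.
Qed.

End Sl2.

(** * Transport along the isomorphism *)

(** The identity of V is central in L(f), so it comes from a central element of
    sl(2, F); as V is nonzero, the identity matrix is then mapped to a nonzero
    scalar a, and the three properties carry over. *)
Lemma form_algebra_heisenberg (F : fieldType) (V : vectType F)
    (f : {biscalar V}) :
  2%N \in [pchar F] -> (exists v : V, v != 0) ->
  lie_isomorphic (sl F 2) (Lform f) ->
  [/\ forall z w, z \in skew_adjoint f -> w \in skew_adjoint f ->
        exists c, lie z w = c *: \1%VF,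
      forall z, z \in skew_adjoint f ->
        (forall w, w \in skew_adjoint f -> lie z w = 0) ->
        exists c, z = c *: \1%VF
    & exists x y : 'End(V),
        [/\ x \in skew_adjoint f, y \in skew_adjoint f & lie x y = \1%VF]].
Proof.
move=> char2 V_neq0 [phi [[psi phiK psiK] phi_lie]].
have psi_lie X Y : psi (lie X Y) = lie (psi X) (psi Y).
  by apply: (can_inj phiK); rewrite psiK phi_lie !psiK.
have psi_centre Z : (forall W, lie Z W = 0) ->
    exists c, psi Z = c *: sl2_one char2.
  move=> ZC; apply: sl2_centre => B; apply: (can_inj phiK).
  by rewrite phi_lie psiK ZC linear0.
have [a a_neq0 phi1] :
    exists2 a, a != 0 & val (phi (sl2_one char2)) = a *: \1%VF.
  pose idL : Lform f := LForm (id_self_adjoint f char2).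
  have [|c id_c] := psi_centre idL.
    move=> W; apply: val_inj.
    by rewrite /= /lie /= /end_lie comp_lfun1l comp_lfun1r subrr.
  have {}id_c : c *: val (phi (sl2_one char2)) = \1%VF.
    by rewrite -[RHS]/(val idL) -(psiK idL) id_c linearZ.
  have c_neq0 : c != 0.
    apply/eqP => c0; have [v /eqP[]] := V_neq0.
    by rewrite -[v](id_lfunE) -id_c c0 scale0r lfunE.
  by exists c^-1; rewrite ?invr_neq0 // -id_c scalerA mulVf ?scale1r.
have phi_scalar c : val (phi (c *: sl2_one char2)) = (c * a) *: \1%VF.
  by rewrite linearZ /= phi1 scalerA.
split.
- move=> z w zL wL; pose Z : Lform f := LForm zL; pose W : Lform f := LForm wL.
  rewrite -[lie z w]/(val (lie Z W)) -(psiK (lie Z W)) psi_lie.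
  by rewrite (sl2_lie char2) phi_scalar; eexists.
- move=> z zL zC; pose Z : Lform f := LForm zL.
  have [|c zc] := psi_centre Z.
    by move=> W; apply: val_inj; apply: zC; apply: valP.
  by exists (c * a); rewrite -[z]/(val Z) -(psiK Z) zc phi_scalar.
exists (val (phi (sl2_e F))), (val (phi (a^-1 *: sl2_f F))).
split; try exact: valP.
rewrite -[LHS]/(val (lie (phi (sl2_e F)) (phi (a^-1 *: sl2_f F)))) -phi_lie.
by rewrite (sl2_lie_ef char2) phi_scalar mulVf ?scale1r.
Qed.

Theorem proposition12p4 (F : fieldType) (V : vectType F) (f : {biscalar V}) :
  2%N \in [pchar F] ->
  (0 < \dim {:V})%N ->
  lie_isomorphic (sl F 2) (Lform f) ->
  [/\ \dim {:V} = 2%N, nondegenerate_form f & alternating_form f].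
Proof.
move=> char2 dim_gt0 iso.
have V_neq0 : exists v : V, v != 0.
  by exists (vpick {:V}); rewrite vpick0 -dimv_eq0 -lt0n.
have [lieL centreL [x [y [xL yL lie_xy]]]] :=
  form_algebra_heisenberg char2 V_neq0 iso.
split.
- exact: form_space_dim char2 lieL centreL _ _ xL yL lie_xy V_neq0.
- exact: form_nondegenerate char2 lieL centreL _ _ xL yL lie_xy V_neq0.
- exact: form_alternating char2 lieL centreL _ _ xL yL lie_xy V_neq0.
Qed.
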